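(* Let $m,n\ge1$ and let $A\in\mathbb{C}^{m\times n}$ have only nonzero entries. Let $U=\begin{bmatrix} I_m\otimes 1_n & -1_m\otimes I_n\end{bmatrix}\in\mathbb{C}^{mn\times(m+n)}$, $b=\operatorname{vec}(A^{[-T]})\in\mathbb{C}^{mn}$, and $$r=\frac1n A^{[-1]}1_n\in\mathbb{C}^m,\qquad c=\frac1m A^{[-T]}1_m\in\mathbb{C}^n,\qquad \sigma=\frac{1}{mn}1_m^TA^{[-1]}1_n\in\mathbb{C}.$$ Then the minimum norm solution of $\min_{s\in\mathbb{C}^m,\,t\in\mathbb{C}^n}\left\|U\begin{bmatrix}s\\t\end{bmatrix}-b\right\|_2$ has the form $$U^+b=\begin{bmatrix} r-\frac{m\sigma}{m+n}1_m\\[2pt] -c+\frac{n\sigma}{m+n}1_n\end{bmatrix},$$ which can be computed in $\mathcal{O}(mn)$ operations. Moreover, $U^+b$ yields Cauchy points (that is, writing $U^+b=\begin{bmatrix}s\\t\end{bmatrix}$ with $s\in\mathbb{C}^m$, $t\in\mathbb{C}^n$, one has $s_i-t_j\ne0$ for all $i,j$) if and only if every component of $UU^+b$ is nonzero, or, equivalently, $r_i+c_j\neq\sigma$ for all $i\in\{1,\dots,m\}$, $j\in\{1,\dots,n\}$.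
   Context: $1_k$ denotes the all-ones column vector of length $k$, $I_k$ the identity matrix, $\otimes$ the Kronecker product, and $U^+$ the Moore–Penrose pseudoinverse of $U$. For a matrix $A=[a_{ij}]$ with all entries nonzero, $A^{[-1]}=[a_{ij}^{-1}]$ is the elementwise inverse and $A^{[-T]}=(A^{[-1]})^T$ (plain transpose, no conjugation). $\operatorname{vec}(B)$ is the vector obtained by stacking the columns of $B$ on top of one another. The minimum norm solution is the least squares minimizer of smallest Euclidean norm. Vectors $s\in\mathbb{C}^m,t\in\mathbb{C}^n$ are called Cauchy points if $s_i-t_j\ne0$ for all $i,j$. Operations are arithmetic operations on complex numbers. *)

(* Defs.v *)
From HB Require Import structures.
From mathcomp Require Import all_boot all_order all_algebra.
From mathcomp Require Import sesquilinear spectral.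
From mathcomp Require Import reals complex mxtens.

Set Implicit Arguments.
Unset Strict Implicit.
Unset Printing Implicit Defensive.

Import Order.TTheory GRing.Theory Num.Theory.
Local Open Scope ring_scope.
Local Open Scope sesquilinear_scope.

Section MoorePenrose.
Variable C : numClosedFieldType.

Definition penrose m n (A : 'M[C]_(m, n)) (X : 'M[C]_(n, m)) : bool :=
  [&& A *m X *m A == A, X *m A *m X == X,
      (A *m X) ^t* == A *m X & (X *m A) ^t* == X *m A].

Lemma ctmxM m n p (A : 'M[C]_(m, n)) (B : 'M[C]_(n, p)) :
  (A *m B) ^t* = B ^t* *m A ^t*.
Proof. by rewrite trmx_mul map_mxM. Qed.

Lemma gram_unitmx m n (F : 'M[C]_(m, n)) :
  row_free F -> F *m F ^t* \in unitmx.
Proof.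
move=> fF; rewrite -row_free_unit -kermx_eq0; apply/rowV0P => u /sub_kermxP.
rewrite mulmxA => uFF; apply/eqP; rewrite -(mulmx_free_eq0 _ fF).
have : dotmx (u *m F) (u *m F) == 0.
  by rewrite dotmxE ctmxM mulmxA uFF mul0mx mxE.
by rewrite dnorm_eq0.
Qed.

Lemma penrose_factor m n r (B : 'M[C]_(m, r)) (F : 'M[C]_(r, n)) :
  F *m F ^t* \in unitmx -> B ^t* *m B \in unitmx ->
  penrose (B *m F)
    (F ^t* *m invmx (F *m F ^t*) *m (invmx (B ^t* *m B) *m B ^t*)).
Proof.
set G := F *m F ^t*; set H := B ^t* *m B => uF uB; set X := (X in penrose _ X).
have AX : B *m F *m X = B *m invmx H *m B ^t*.
  rewrite /X -!mulmxA; congr (B *m _).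
  by rewrite [F *m (F ^t* *m _)]mulmxA mulKVmx.
have XA : X *m (B *m F) = F ^t* *m invmx G *m F.
  rewrite /X -!mulmxA; congr (F ^t* *m (_ *m _)).
  by rewrite [B ^t* *m (B *m _)]mulmxA mulKmx.
have GC : G ^t* = G by rewrite ctmxM trmxCK.
have HC : H ^t* = H by rewrite ctmxM trmxCK.
have ctV k (M : 'M[C]_k) : (invmx M) ^t* = invmx (M ^t*).
  by rewrite trmx_inv map_invmx.
apply/and4P; split; apply/eqP.
- by rewrite AX -!mulmxA [B ^t* *m (B *m _)]mulmxA mulKmx.
- by rewrite XA /X -!mulmxA [F *m (F ^t* *m _)]mulmxA mulKVmx.
- by rewrite AX !ctmxM trmxCK ctV HC mulmxA.
- by rewrite XA !ctmxM trmxCK ctV GC mulmxA.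
Qed.

Lemma penrose_exists m n (A : 'M[C]_(m, n)) : exists X, penrose A X.
Proof.
rewrite -[A]mulmx_base; eexists; apply: penrose_factor.
  by apply: gram_unitmx; apply: row_base_free.
rewrite -{2}[col_base A]trmxCK; apply: gram_unitmx.
by rewrite /row_free mxrank_map mxrank_tr; exact: col_base_full.
Qed.

Lemma penrose_uniq m n (A : 'M[C]_(m, n)) (X Y : 'M[C]_(n, m)) :
  penrose A X -> penrose A Y -> X = Y.
Proof.
move=> /and4P[/eqP X1 /eqP X2 /eqP X3 /eqP X4].
move=> /and4P[/eqP Y1 /eqP Y2 /eqP Y3 /eqP Y4].
have EA : A *m X = A *m Y.
  by rewrite -X3 -{1}Y1 -mulmxA ctmxM X3 Y3 mulmxA X1.
have EX : X *m A = Y *m A.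
  by rewrite -X4 -{1}Y1 -[A *m Y *m A]mulmxA mulmxA ctmxM X4 Y4 -mulmxA
     (mulmxA A) X1.
by rewrite -X2 -mulmxA EA mulmxA EX Y2.
Qed.

Definition mpinv m n (A : 'M[C]_(m, n)) : 'M[C]_(n, m) :=
  xchoose (penrose_exists A).

Lemma mpinvP m n (A : 'M[C]_(m, n)) : penrose A (mpinv A).
Proof. exact: xchooseP. Qed.

(* The values of l2norm are nonnegative reals of C, on which the partial order
   of C is the usual order. *)
Definition l2norm n (x : 'cV[C]_n) : C := sqrtC (\sum_i `|x i 0| ^+ 2).

Definition lsq_minimizer m n (U : 'M[C]_(m, n)) (b : 'cV[C]_m)
    (x : 'cV[C]_n) : Prop :=
  forall y : 'cV[C]_n, l2norm (U *m x - b) <= l2norm (U *m y - b).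

Definition min_norm_solution m n (U : 'M[C]_(m, n)) (b : 'cV[C]_m)
    (x : 'cV[C]_n) : Prop :=
  lsq_minimizer U b x /\
  forall y : 'cV[C]_n, lsq_minimizer U b y -> l2norm x <= l2norm y.

End MoorePenrose.

Section CauchyPoints.
Variable F : fieldType.

Definition ones n : 'cV[F]_n := const_mx 1.

Definition hinv m n (A : 'M[F]_(m, n)) : 'M[F]_(m, n) := map_mx GRing.inv A.

(* mxvec concatenates rows, hence the transpose. *)
Definition vec p q (B : 'M[F]_(p, q)) : 'cV[F]_(q * p) := (mxvec B^T)^T.

(* The casts identify the widths m * 1 and 1 * n of the Kronecker products with
   m and n. *)
Definition Umx m n : 'M[F]_(m * n, m + n) :=
  row_mx (castmx (erefl _, muln1 m) (tensmx (1%:M : 'M_m) (ones n)))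
         (castmx (erefl _, mul1n n) (tensmx (- ones m) (1%:M : 'M_n))).

Definition bvec m n (A : 'M[F]_(m, n)) : 'cV[F]_(m * n) := vec (hinv A)^T.

Definition row_mean m n (A : 'M[F]_(m, n)) : 'cV[F]_m :=
  n%:R^-1 *: (hinv A *m ones n).

Definition col_mean m n (A : 'M[F]_(m, n)) : 'cV[F]_n :=
  m%:R^-1 *: ((hinv A)^T *m ones m).

Definition total_mean m n (A : 'M[F]_(m, n)) : F :=
  (m * n)%:R^-1 * ((ones m)^T *m hinv A *m ones n) 0 0.

Definition nonzero_entries m n (A : 'M[F]_(m, n)) : Prop :=
  forall i j, A i j != 0.

Definition cauchy_points m n (s : 'cV[F]_m) (t : 'cV[F]_n) : Prop :=
  forall i j, s i 0 - t j 0 != 0.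

End CauchyPoints.

Arguments ones {F} n.
Arguments Umx F m n : clear implicits.

(* Arithmetic straight-line programs with inputs indexed by I and outputs
   indexed by O.  Each instruction performs one field operation and appends its
   result to the list of registers; the cost is the number of instructions.
   Operands are inputs, natural-number constants, or earlier registers. *)
Variant arith_op := OpAdd | OpSub | OpMul | OpDiv.

Variant operand (I : Type) := Input of I | Const of nat | Reg of nat.

Record instr (I : Type) :=
  Instr { instr_op : arith_op; instr_l : operand I; instr_r : operand I }.

Record slp (I O : Type) :=
  Slp { slp_code : seq (instr I); slp_out : O -> operand I }.

Definition slp_cost I O (P : slp I O) : nat := size (slp_code P).

Section Semantics.
Variables (F : fieldType) (I : Type) (env : I -> F).

Definition eval_operand (regs : seq F) (a : operand I) : option F :=
  match a with
  | Input i => Some (env i)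
  | Const k => Some k%:R
  | Reg l => onth regs l
  end.

(* None marks a division by zero or a reference to a missing register. *)
Definition eval_op (o : arith_op) (x y : F) : option F :=
  match o with
  | OpAdd => Some (x + y)
  | OpSub => Some (x - y)
  | OpMul => Some (x * y)
  | OpDiv => if y == 0 then None else Some (x / y)
  end.

Definition eval_instr (regs : seq F) (c : instr I) : option F :=
  if eval_operand regs (instr_l c) is Some x then
    if eval_operand regs (instr_r c) is Some y then eval_op (instr_op c) x y
    else None
  else None.

Fixpoint run_code (regs : seq F) (code : seq (instr I)) : option (seq F) :=
  if code is c :: code' then
    if eval_instr regs c is Some v then run_code (rcons regs v) code' else None
  else Some regs.

Definition slp_computes O (P : slp I O) (f : O -> F) : Prop :=
  exists2 regs, run_code [::] (slp_code P) = Some regs &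
    forall o, eval_operand regs (slp_out P o) = Some (f o).

End Semantics.

(* Main.v *)
Require Import Defs.
From mathcomp Require Import all_boot all_order all_algebra.
From mathcomp Require Import sesquilinear spectral.
From mathcomp Require Import reals complex mxtens ring zify.

Set Implicit Arguments.
Unset Strict Implicit.
Unset Printing Implicit Defensive.

Import Order.TTheory GRing.Theory Num.Theory.
Local Open Scope ring_scope.
Local Open Scope sesquilinear_scope.

(** The normal equations split everything into orthogonal parts.  With
    [x0 := mpinv U *m b], the residual of [x0] is orthogonal to the range of
    [U], and [x0] is orthogonal to its kernel.  Two applications of Pythagoras
    then show that the least squares minimizers are exactly [x0 + ker U], and
    that [x0] is the only one of smallest norm ([min_norm_solutionE]).  The same
    two orthogonality relations characterize [x0] ([mpinv_mulmx_unique]), so a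
    closed form for [mpinv U *m b] is proved without computing [mpinv U].

    For the matrix of the theorem, [U *m col_mx s t] lists the differences
    [s i - t j], so [ker U] is spanned by the all-ones vector, and the normal
    equations say that all row sums and all column sums of the residual
    [s i - t j - (A i j)^-1] vanish.  The proposed vector [centered_means]
    satisfies [s i - t j = r i + c j - sigma], the least squares additive fit of
    the entries [(A i j)^-1], for which these sums do vanish; and its
    coordinates add up to 0, which makes it orthogonal to [ker U].  The
    criterion for Cauchy points is read off from these differences.

    For the operation count, the program inverts the entries of [A] and sums the
    inverses along rows and along columns, in [3 * m * n] operations; the rest
    is a bounded number of operations per row and per column.  Its correctness
    is tracked by [known code f], the function [f] of the input is held by some
    operand after [code] has run, and by [extends], which says that a longer
    code keeps what was known. *)

(** * Least squares and the Moore-Penrose inverse *)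

Section MinimumNorm.
Variable C : numClosedFieldType.

(** Squared norms add up for orthogonal vectors, and comparing them avoids the
    square root of [l2norm]. *)
Definition sqnorm n (x : 'cV[C]_n) : C := \sum_i `|x i 0| ^+ 2.

Lemma sqnormE n (x : 'cV[C]_n) : sqnorm x = (x ^t* *m x) 0 0.
Proof.
by rewrite mxE; apply: eq_bigr => i _; rewrite !mxE normCK mulrC.
Qed.

Lemma sqnorm_ge0 n (x : 'cV[C]_n) : 0 <= sqnorm x.
Proof. by apply: sumr_ge0 => i _; rewrite exprn_ge0. Qed.

Lemma sqnorm_le0 n (x : 'cV[C]_n) : sqnorm x <= 0 -> x = 0.
Proof.
move=> x_le0; have /eqP: sqnorm x = 0.
  by apply/le_anti; rewrite x_le0 sqnorm_ge0.
rewrite psumr_eq0 => [/allP x0|i _]; last by rewrite exprn_ge0.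
apply/colP => i; apply/eqP; rewrite mxE.
by have := x0 i; rewrite mem_index_enum sqrf_eq0 normr_eq0 => /(_ isT).
Qed.

Lemma le_l2norm m n (x : 'cV[C]_m) (y : 'cV[C]_n) :
  (l2norm x <= l2norm y) = (sqnorm x <= sqnorm y).
Proof. by rewrite ler_sqrtC // qualifE /= sqnorm_ge0. Qed.

Lemma self_orthogonal0 n (x : 'cV[C]_n) : x ^t* *m x = 0 -> x = 0.
Proof. by move=> xx0; apply: sqnorm_le0; rewrite sqnormE xx0 mxE. Qed.

Lemma ctmxD m n (A B : 'M[C]_(m, n)) : (A + B) ^t* = A ^t* + B ^t*.
Proof. by apply/matrixP => i j; rewrite !mxE rmorphD. Qed.

Lemma pythagoras n (x y : 'cV[C]_n) :
  x ^t* *m y = 0 -> sqnorm (x + y) = sqnorm x + sqnorm y.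
Proof.
move=> xy0; have yx0 : y ^t* *m x = 0.
  by rewrite -[LHS]trmxCK ctmxM trmxCK xy0 trmx0 map_mx0.
by rewrite !sqnormE ctmxD mulmxDl !mulmxDr xy0 yx0 addr0 add0r mxE.
Qed.

Section Pseudoinverse.
Variables (m n : nat) (U : 'M[C]_(m, n)) (b : 'cV[C]_m).
Local Notation x0 := (mpinv U *m b).

(** As [U *m mpinv U] is Hermitian, [U ^t* *m U *m mpinv U] is the conjugate
    transpose of [U *m mpinv U *m U = U]. *)
Lemma normal_equations_mpinv : U ^t* *m (U *m x0 - b) = 0.
Proof.
have /and4P[/eqP UXU _ /eqP UXC _] := mpinvP U.
by rewrite mulmxBr (mulmxA U) -UXC mulmxA -ctmxM UXU subrr.
Qed.

(** [x0] is in the range of [mpinv U *m U], which is Hermitian and kills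
    [ker U]. *)
Lemma mpinv_orthogonal_ker (d : 'cV[C]_n) : U *m d = 0 -> d ^t* *m x0 = 0.
Proof.
have /and4P[_ /eqP XUX _ /eqP XUC] := mpinvP U => Ud0.
rewrite -XUX -XUC !mulmxA -ctmxM -(mulmxA _ U) Ud0.
by rewrite mulmx0 trmx0 map_mx0 !mul0mx.
Qed.

(** By the normal equations, [U *m (y - x0)] is orthogonal to the residual of
    [x0]. *)
Lemma sqnorm_residual y :
  sqnorm (U *m y - b) = sqnorm (U *m (y - x0)) + sqnorm (U *m x0 - b).
Proof.
rewrite -pythagoras; first by rewrite mulmxBr addrA subrK.
by rewrite ctmxM -mulmxA normal_equations_mpinv mulmx0.
Qed.

Lemma lsq_minimizerE y : lsq_minimizer U b y <-> U *m (y - x0) = 0.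
Proof.
split=> [ymin|Uy0 z]; last first.
  rewrite le_l2norm (sqnorm_residual y) (sqnorm_residual z) Uy0 lerD2r.
  by rewrite /sqnorm big1 ?sqnorm_ge0 // => i _; rewrite mxE normr0 expr0n.
apply: sqnorm_le0; have := ymin x0.
by rewrite le_l2norm (sqnorm_residual y) gerDr.
Qed.

(** [y - x0] is in [ker U], to which [x0] is orthogonal. *)
Lemma sqnorm_lsq_minimizer y :
  lsq_minimizer U b y -> sqnorm y = sqnorm (y - x0) + sqnorm x0.
Proof.
by move=> /lsq_minimizerE Uy0; rewrite -pythagoras ?subrK ?mpinv_orthogonal_ker.
Qed.

Lemma min_norm_solutionE y : min_norm_solution U b y <-> y = x0.
Proof.
have x0min : lsq_minimizer U b x0 by apply/lsq_minimizerE; rewrite subrr mulmx0.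
split=> [[ymin yle]|->].
  apply/eqP; rewrite -subr_eq0; apply/eqP; apply: sqnorm_le0.
  by have := yle _ x0min; rewrite le_l2norm (sqnorm_lsq_minimizer ymin) gerDr.
split=> // z zmin.
by rewrite le_l2norm (sqnorm_lsq_minimizer zmin) lerDr sqnorm_ge0.
Qed.

(** Two solutions of the normal equations differ by an element of [ker U]; if
    both are orthogonal to [ker U], so is their difference, which therefore is
    orthogonal to itself. *)
Lemma mpinv_mulmx_unique x :
  U ^t* *m (U *m x - b) = 0 ->
  (forall d : 'cV[C]_n, U *m d = 0 -> d ^t* *m x = 0) -> x = x0.
Proof.
move=> xnormal xker; apply/eqP; rewrite -subr_eq0; apply/eqP.
have Ud0 : U *m (x - x0) = 0.
  apply: self_orthogonal0; rewrite ctmxM -mulmxA.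
  rewrite [U ^t* *m _](_ : _ = 0) ?mulmx0 //.
  have -> : U *m (x - x0) = (U *m x - b) - (U *m x0 - b).
    by rewrite mulmxBr opprB addrA subrK.
  by rewrite mulmxBr xnormal normal_equations_mpinv subrr.
by apply: self_orthogonal0; rewrite mulmxBr xker ?mpinv_orthogonal_ker ?subrr.
Qed.

End Pseudoinverse.
End MinimumNorm.

(** * The matrix of pairwise differences *)

Lemma enum_rank_prod (T1 T2 : finType) (x : T1) (y : T2) :
  enum_rank (x, y) = (enum_rank x * #|T2| + enum_rank y)%N :> nat.
Proof.
have rankE (T : finType) (z : T) : enum_rank z = index z (enum T) :> nat.
  rewrite -[in RHS](nth_enum_rank z z) index_uniq ?enum_uniq //.
  by rewrite -cardE ltn_ord.
rewrite !rankE [enum {: T1 * T2}]enumT unlock /= /prod_enum cardE.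
have: x \in enum T1 by rewrite mem_enum.
elim: (enum T1) => //= a s IHs; rewrite inE index_cat size_map.
have -> : ((x, y) \in [seq (a, z) | z <- enum T2]) = (a == x).
  apply/mapP/eqP => [[z _ [-> _]] //|->]; exists y => //; exact: mem_enum.
rewrite eq_sym; case: eqP => [->|/eqP ax /= xs].
  by rewrite (index_map (f := pair x)) // => u v [].
by rewrite IHs // mulSn addnA.
Qed.

Section DifferenceMatrix.
Variable F : fieldType.
Variables m n : nat.

(** Kronecker products and [mxvec] flatten pairs of indices independently, the
    former by arithmetic, the latter by the enumeration of a product type; both
    orders are row-major, so that the rows of [Umx] and the entries of [bvec]
    are aligned. *)
Lemma mxvec_index_mxtens (i : 'I_m) (j : 'I_n) :
  mxvec_index i j = mxtens_index (i, j).
Proof.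
by apply: val_inj; rewrite /= enum_rank_prod !enum_rank_ord /= card_ord.
Qed.

Lemma bvecE (A : 'M[F]_(m, n)) i j :
  bvec A (mxtens_index (i, j)) 0 = (A i j)^-1.
Proof. by rewrite /bvec /vec trmxK mxE -mxvec_index_mxtens mxvecE mxE. Qed.

Lemma Umx_lshift i j k :
  Umx F m n (mxtens_index (i, j)) (lshift n k) = (i == k)%:R.
Proof.
rewrite row_mxEl castmxE /= cast_ord_id.
have -> : cast_ord (esym (muln1 m)) k = mxtens_index (k, 0).
  by apply: val_inj; rewrite /= muln1 addn0.
by rewrite tensmxE !mxE mulr1.
Qed.

Lemma Umx_rshift i j l :
  Umx F m n (mxtens_index (i, j)) (rshift m l) = - (j == l)%:R.
Proof.
rewrite row_mxEr castmxE /= cast_ord_id.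
have -> : cast_ord (esym (mul1n n)) l = mxtens_index (0, l).
  by apply: val_inj.
by rewrite tensmxE !mxE mulN1r.
Qed.

Lemma mul_Umx (x : 'cV[F]_(m + n)) i j :
  (Umx F m n *m x) (mxtens_index (i, j)) 0 = usubmx x i 0 - dsubmx x j 0.
Proof.
rewrite mxE big_split_ord /= !mxE; congr (_ + _).
  rewrite (bigD1 i) //= Umx_lshift eqxx mul1r big1 ?addr0 // => k /negPf ki.
  by rewrite Umx_lshift eq_sym ki mul0r.
rewrite (bigD1 j) //= Umx_rshift eqxx mulN1r big1 ?addr0 // => k /negPf ki.
by rewrite Umx_rshift eq_sym ki oppr0 mul0r.
Qed.

Lemma sum_mxtens_index (V : nmodType) (f : 'I_(m * n) -> V) :
  \sum_k f k = \sum_i \sum_j f (mxtens_index (i, j)).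
Proof.
rewrite (reindex (@mxtens_index m n)) /=; last first.
  exists (@mxtens_unindex m n) => k _; first exact: mxtens_indexK.
  exact: mxtens_unindexK.
by rewrite pair_big; apply: eq_bigr => -[i j].
Qed.

Lemma mul_tr_Umx (v : 'cV[F]_(m * n)) :
  (Umx F m n)^T *m v =
    col_mx (\col_i \sum_j v (mxtens_index (i, j)) 0)
           (\col_j - \sum_i v (mxtens_index (i, j)) 0).
Proof.
apply/colP => k; rewrite mxE sum_mxtens_index.
case: (split_ordP k) => [i|j] ->.
  rewrite col_mxEu mxE (bigD1 i) //= [X in _ + X]big1 => [|i' /negPf i'i].
    by rewrite addr0; apply: eq_bigr => j _; rewrite mxE Umx_lshift eqxx mul1r.
  by rewrite big1 // => j _; rewrite mxE Umx_lshift i'i mul0r.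
rewrite col_mxEd mxE exchange_big (bigD1 j) //= [X in _ + X]big1.
  rewrite addr0 -sumrN; apply: eq_bigr => i _.
  by rewrite mxE Umx_rshift eqxx mulN1r.
move=> j' /negPf j'j.
by rewrite big1 // => i _; rewrite mxE Umx_rshift j'j oppr0 mul0r.
Qed.

Lemma cauchy_pointsE (x : 'cV[F]_(m + n)) :
  cauchy_points (usubmx x) (dsubmx x) <->
    (forall k, (Umx F m n *m x) k 0 != 0).
Proof.
split=> [st k|Ux i j]; first by case: (mxtens_indexP k) => i j; rewrite mul_Umx.
by rewrite -mul_Umx.
Qed.

End DifferenceMatrix.

(** * Means of the inverse entries *)

Section Means.
Variables (F : numFieldType) (m n : nat) (A : 'M[F]_(m, n)).
Hypotheses (m_gt0 : (0 < m)%N) (n_gt0 : (0 < n)%N).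

Let mF0 : m%:R != 0 :> F. Proof. by rewrite pnatr_eq0 -lt0n. Qed.
Let nF0 : n%:R != 0 :> F. Proof. by rewrite pnatr_eq0 -lt0n. Qed.

Lemma row_meanE i : row_mean A i 0 = (\sum_j (A i j)^-1) / n%:R.
Proof.
rewrite mxE mxE mulrC; congr (_ / _).
by apply: eq_bigr => j _; rewrite !mxE mulr1.
Qed.

Lemma col_meanE j : col_mean A j 0 = (\sum_i (A i j)^-1) / m%:R.
Proof.
rewrite mxE mxE mulrC; congr (_ / _).
by apply: eq_bigr => i _; rewrite !mxE mulr1.
Qed.

Lemma total_meanE : total_mean A = (\sum_i \sum_j (A i j)^-1) / (m * n)%:R.
Proof.
rewrite /total_mean mulrC -mulmxA mxE; congr (_ / _).
apply: eq_bigr => i _; rewrite !mxE mul1r.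
by apply: eq_bigr => j _; rewrite !mxE mulr1.
Qed.

Lemma sum_inv_row i : \sum_j (A i j)^-1 = row_mean A i 0 *+ n.
Proof. by rewrite row_meanE -[RHS]mulr_natr divfK. Qed.

Lemma sum_inv_col j : \sum_i (A i j)^-1 = col_mean A j 0 *+ m.
Proof. by rewrite col_meanE -[RHS]mulr_natr divfK. Qed.

Lemma sum_row_mean : \sum_i row_mean A i 0 = total_mean A *+ m.
Proof.
rewrite -mulr_natl.
under eq_bigr do rewrite row_meanE.
by rewrite -mulr_suml total_meanE natrM invfM mulrCA mulVKf.
Qed.

Lemma sum_col_mean : \sum_j col_mean A j 0 = total_mean A *+ n.
Proof.
rewrite -mulr_natl.
under eq_bigr do rewrite col_meanE.
rewrite -mulr_suml exchange_big total_meanE mulnC natrM invfM.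
by rewrite [RHS]mulrCA mulVKf.
Qed.

End Means.

(** * The closed form of the minimum norm solution *)

Section ClosedForm.
Variables (C : numClosedFieldType) (m n : nat) (A : 'M[C]_(m, n)).
Hypotheses (m_gt0 : (0 < m)%N) (n_gt0 : (0 < n)%N).
Local Notation U := (Umx C m n).
Local Notation r := (row_mean A).
Local Notation c := (col_mean A).
Local Notation sigma := (total_mean A).

Definition centered_means : 'cV[C]_(m + n) :=
  col_mx (r - (m%:R * sigma / (m + n)%:R) *: ones m)
         (- c + (n%:R * sigma / (m + n)%:R) *: ones n).

Let mnC0 : m%:R + n%:R != 0 :> C.
Proof. by rewrite -natrD pnatr_eq0 -lt0n addn_gt0 m_gt0. Qed.

Lemma centered_means_lshift i :
  centered_means (lshift n i) 0 = r i 0 - m%:R * sigma / (m + n)%:R.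
Proof. by rewrite col_mxEu mxE; congr (_ + _); rewrite !mxE mulr1. Qed.

Lemma centered_means_rshift j :
  centered_means (rshift m j) 0 = n%:R * sigma / (m + n)%:R - c j 0.
Proof.
by rewrite col_mxEd mxE addrC; congr (_ + _); rewrite mxE // mxE mulr1.
Qed.

(** The multiples [m / (m + n)] and [n / (m + n)] of [sigma] add up to
    [sigma]. *)
Lemma Umx_centered_means i j :
  (U *m centered_means) (mxtens_index (i, j)) 0 = r i 0 + c j 0 - sigma.
Proof.
rewrite mul_Umx [usubmx _ _ _]mxE [dsubmx _ _ _]mxE.
rewrite centered_means_lshift centered_means_rshift natrD.
by field; rewrite mnC0.
Qed.

(** The entries of [U] are real. *)
Lemma ctmx_Umx : U ^t* = U^T.
Proof.
apply/matrixP => k l; rewrite [LHS]mxE mxE.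
case: (mxtens_indexP l) => i j; case: (split_ordP k) => k' ->.
  by rewrite Umx_lshift conjC_nat.
by rewrite Umx_rshift rmorphN /= conjC_nat.
Qed.

(** The row sums of the residual are
    [n * r i + n * sigma - n * sigma - n * r i = 0], since the column means add
    up to [n * sigma]; the column sums are symmetric. *)
Lemma centered_means_normal : U ^t* *m (U *m centered_means - bvec A) = 0.
Proof.
rewrite ctmx_Umx.
have resE i j : (U *m centered_means - bvec A) (mxtens_index (i, j)) 0 =
    r i 0 + c j 0 - sigma - (A i j)^-1.
  by rewrite -Umx_centered_means -bvecE mxE; congr (_ + _); rewrite mxE.
rewrite mul_tr_Umx; apply/colP => k; case: (split_ordP k) => k' ->.
  rewrite col_mxEu mxE [RHS]mxE; under eq_bigr do rewrite resE.
  rewrite !big_split /= !sumrN sum_col_mean // !sumr_const !card_ord.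
  by rewrite sum_inv_row // addrK subrr.
rewrite col_mxEd mxE [RHS]mxE; under eq_bigr do rewrite resE.
rewrite !big_split /= !sumrN sum_row_mean // !sumr_const !card_ord.
by rewrite sum_inv_col // addrAC addrK subrr oppr0.
Qed.

(** The kernel of [U] is spanned by the all-ones vector, so this is the
    orthogonality to [ker U]; it determines how [sigma] is distributed between
    the two blocks of [centered_means]. *)
Lemma sum_centered_means : \sum_k centered_means k 0 = 0.
Proof.
rewrite big_split_ord /=.
under eq_bigr do rewrite centered_means_lshift.
under [X in _ + X]eq_bigr do rewrite centered_means_rshift.
rewrite !big_split /= !sumrN sum_row_mean // sum_col_mean //.
rewrite !sumr_const !card_ord -(mulr_natl _ n) -(mulr_natl sigma m).
by rewrite -(mulr_natl _ m) -(mulr_natl sigma n) natrD; field; rewrite mnC0.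
Qed.

Lemma ker_Umx (d : 'cV[C]_(m + n)) :
  U *m d = 0 -> exists a, d = const_mx a.
Proof.
move=> Ud0; pose i0 := Ordinal m_gt0; pose j0 := Ordinal n_gt0.
have st i j : d (lshift n i) 0 = d (rshift m j) 0.
  apply/eqP; rewrite -subr_eq0; have := mul_Umx d i j.
  by rewrite Ud0 !mxE => <-.
exists (d (rshift m j0) 0); apply/colP => k; rewrite mxE.
by case: (split_ordP k) => k' ->; rewrite -?(st i0 k') (st _ j0).
Qed.

Lemma mpinv_Umx : mpinv U *m bvec A = centered_means.
Proof.
apply/esym/mpinv_mulmx_unique; first exact: centered_means_normal.
move=> d /ker_Umx[a ->]; apply/matrixP => i j; rewrite !ord1 mxE [RHS]mxE.
under eq_bigr => k _ do rewrite [_ ^t* _ _]mxE [_^T _ _]mxE mxE.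
by rewrite -mulr_sumr sum_centered_means mulr0.
Qed.

End ClosedForm.

(** * Straight-line programs *)

Section OperationCount.
Variables (F : fieldType) (I T : Type) (inp : T -> I -> F) (D : T -> Prop).
Implicit Types (code : seq (instr I)) (f g : T -> F).

(** The operand may not depend on [t]: one program serves all inputs [inp t]
    with [D t].  A code that fails on such an input knows nothing. *)
Definition known code f : Prop :=
  exists a : operand I, forall t, D t ->
    exists2 regs, run_code (inp t) [::] code = Some regs &
      eval_operand (inp t) regs a = Some (f t).

(** Only the known functions are compared, not the registers themselves, so
    that pieces of program are composed without naming registers. *)
Definition extends k code code' : Prop :=
  (size code' <= size code + k)%N /\ forall f, known code f -> known code' f.

Definition op_val (o : arith_op) (x y : F) : F :=
  match o with
  | OpAdd => x + y | OpSub => x - y | OpMul => x * y | OpDiv => x / y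
  end.

Lemma known_nil_const k : known [::] (fun => k%:R).
Proof. by exists (Const I k) => t _; exists [::]. Qed.

Lemma known_const code f k : known code f -> known code (fun => k%:R).
Proof. by case=> a fP; exists (Const I k) => t /fP[regs]; exists regs. Qed.

Lemma known_input code f i : known code f -> known code (inp^~ i).
Proof. by case=> a fP; exists (Input i) => t /fP[regs]; exists regs. Qed.

Lemma eq_known code f g :
  (forall t, D t -> f t = g t) -> known code f -> known code g.
Proof. by move=> fg [a fP]; exists a => t Dt; rewrite -fg //; apply: fP. Qed.

Lemma extends_refl code : extends 0 code code.
Proof. by split; rewrite ?addn0. Qed.

Lemma extends_trans k l code1 code2 code3 :
  extends k code1 code2 -> extends l code2 code3 -> extends (k + l) code1 code3.
Proof.
move=> [s12 k12] [s23 k23]; split=> [|f /k12/k23//].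
by rewrite addnA; apply: leq_trans s23 _; rewrite leq_add2r.
Qed.

Lemma run_code_rcons env regs code (c : instr I) :
  run_code env regs (rcons code c) =
  obind (fun regs' => omap (rcons regs') (eval_instr env regs' c))
        (run_code (F := F) env regs code).
Proof.
elim: code regs => [|c' code IHcode] regs /=; first by case: (eval_instr _ _ _).
by case: (eval_instr _ _ _).
Qed.

Lemma size_run_code env code regs regs' :
  run_code (F := F) (I := I) env regs code = Some regs' ->
  size regs' = (size regs + size code)%N.
Proof.
elim: code regs => [|c code IHcode] regs /= => [[<-]|]; first by rewrite addn0.
by case: (eval_instr _ _ _) => // v /IHcode ->; rewrite size_rcons addSnnS.
Qed.

Lemma eval_operand_rcons env regs v (a : operand I) x :
  eval_operand env regs a = Some x ->
  eval_operand (F := F) env (rcons regs v) a = Some x.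
Proof.
case: a => //= l rl; rewrite -cats1 onth_cat ifT //.
by rewrite -onthTE rl.
Qed.

Lemma known_op o code f g :
  known code f -> known code g -> (o = OpDiv -> forall t, D t -> g t != 0) ->
  exists2 code', extends 1 code code' &
    known code' (fun t => op_val o (f t) (g t)).
Proof.
move=> [a fP] [b gP] g0.
have runP t regs : D t -> run_code (inp t) [::] code = Some regs ->
    run_code (inp t) [::] (rcons code (Instr o a b)) =
      Some (rcons regs (op_val o (f t) (g t))).
  move=> Dt rE; have [ra + fE] := fP _ Dt; have [rb + gE] := gP _ Dt.
  rewrite rE => -[?] [?]; subst ra rb.
  rewrite run_code_rcons rE /= /eval_instr /= fE gE.
  by case: o g0 => //= /(_ erefl _ Dt)/negPf ->.
exists (rcons code (Instr o a b)).
  split=> [|h [c hP]]; first by rewrite size_rcons addn1.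
  exists c => t Dt; have [regs rE hE] := hP _ Dt.
  by eexists; [apply: runP rE|apply: eval_operand_rcons].
exists (Reg I (size code)) => t Dt; have [regs rE _] := fP _ Dt.
eexists; first exact: runP rE.
by rewrite /= -cats1 onth_cat (size_run_code rE) ltnn subnn.
Qed.

(** The step is required from every code that knows what [code] does, because
    by the time the [j]-th function is computed, instructions for the other
    indices have been appended. *)
Lemma known_family (J : finType) (h : J -> T -> F) k code :
  (forall j code1, (forall f, known code f -> known code1 f) ->
     exists2 code2, extends k code1 code2 & known code2 (h j)) ->
  exists2 code', extends (#|J| * k) code code' & forall j, known code' (h j).
Proof.
move=> stepP; suff [code' ext hP] : exists2 code',
    extends (size (enum J) * k) code code' &
    {in enum J, forall j, known code' (h j)}.
  by exists code'; rewrite ?cardE // => j; apply: hP; rewrite mem_enum.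
elim: (enum J) => [|j s [code1 ext1 hP]].
  by exists code; first exact: extends_refl.
have [code2 ext2 hj] := stepP j code1 ext1.2.
exists code2; first by rewrite /= mulSn addnC; apply: extends_trans ext1 ext2.
by move=> i; rewrite inE => /predU1P[->//|/hP]; apply: ext2.2.
Qed.

Lemma known_family_op (J : finType) o (f g : J -> T -> F) code :
  (forall j, known code (f j)) -> (forall j, known code (g j)) ->
  (o = OpDiv -> forall j t, D t -> g j t != 0) ->
  exists2 code', extends #|J| code code' &
    forall j, known code' (fun t => op_val o (f j t) (g j t)).
Proof.
move=> fP gP g0; rewrite -[#|J|]muln1; apply: known_family => j code1 sub1.
by apply: known_op => [||/g0 /(_ j)]; [exact: sub1 | exact: sub1 | ].
Qed.

(** The accumulator starts from the constant 0, which costs one addition per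
    term and covers empty sums. *)
Lemma known_sum (J : finType) (f : J -> T -> F) code :
  known code (fun => 0%:R) -> (forall j, known code (f j)) ->
  exists2 code', extends #|J| code code' & known code' (fun t => \sum_j f j t).
Proof.
move=> c0 fP; rewrite cardE.
suff [code' ext hP] : exists2 code', extends (size (enum J)) code code' &
    known code' (fun t => \sum_(j <- enum J) f j t).
  by exists code' => //; apply: eq_known hP => t _; rewrite big_enum.
elim: (enum J) => [|j s [code1 ext1 hP]].
  exists code; first exact: extends_refl.
  by apply: eq_known c0 => t _; rewrite big_nil.
have [//|code2 ext2 hj] := known_op (o := OpAdd) (ext1.2 _ (fP j)) hP.
exists code2; first by rewrite /= -addn1; apply: extends_trans ext1 ext2.
by apply: eq_known hj => t _; rewrite big_cons.
Qed.

Lemma slp_of_known (O : finType) (h : O -> T -> F) code :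
  known code (fun => 0%:R) -> (forall o, known code (h o)) ->
  exists2 P : slp I O, slp_cost P = size code &
    forall t, D t -> slp_computes (inp t) P (h^~ t).
Proof.
move=> [z c0] /fin_all_exists[out outP]; exists (Slp code out) => // t Dt.
have [regs rE _] := c0 _ Dt; exists regs => // o.
by have [regs'] := outP o _ Dt; rewrite rE => -[<-].
Qed.

End OperationCount.

(** * A linear-size program for the minimum norm solution *)

Section MeansProgram.
Variables (C : numClosedFieldType) (m n : nat).
Hypotheses (m_gt0 : (0 < m)%N) (n_gt0 : (0 < n)%N).
Local Notation inp := (fun (A : 'M[C]_(m, n)) ij => A ij.1 ij.2).
Local Notation D := (@nonzero_entries C m n).

(** The inverses, row sums and column sums take [m * n] operations each, the
    total [m], the means [m + n], the constants built from [sigma] five, and the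
    outputs [m + n]; as [m], [n] and 1 are at most [m * n], the sum
    [3 * m * n + 3 * m + 2 * n + 5] is at most [13 * (m * n)]. *)
Lemma centered_means_program :
  exists2 P : slp ('I_m * 'I_n) 'I_(m + n), (slp_cost P <= 13 * (m * n))%N &
    forall A, D A -> slp_computes (inp A) P (fun k => centered_means A k 0).
Proof.
have mC0 : m%:R != 0 :> C by rewrite pnatr_eq0 -lt0n.
have nC0 : n%:R != 0 :> C by rewrite pnatr_eq0 -lt0n.
have mnC0 : (m + n)%:R != 0 :> C by rewrite pnatr_eq0 -lt0n addn_gt0 m_gt0.
have k0 k : known inp D [::] (fun=> k%:R) := known_nil_const inp D k.
have [c1 [s1 e1] inv1] : exists2 c1, extends inp D #|{: 'I_m * 'I_n}| [::] c1 &
    forall ij, known inp D c1 (fun A => (A ij.1 ij.2)^-1).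
  have [||_ ij A|c1 e1 h1] := @known_family_op _ _ _ inp D _ OpDiv
    (fun _ _ => 1%:R) (fun ij A => A ij.1 ij.2) [::]; [by []| |exact|].
    by move=> ij; apply: known_input (k0 0%N).
  by exists c1 => // ij; apply: eq_known (h1 ij) => A _ /=; rewrite div1r.
(* Row sums and column sums. *)
have [i c e|c2 [s2 e2] row2] := @known_family _ _ _ inp D _
    (fun i A => \sum_j (A i j)^-1) #|'I_n| c1.
  apply: known_sum => [|j]; first exact/e/e1.
  exact: e _ (inv1 (i, j)).
have [j c e|c3 [s3 e3] col3] := @known_family _ _ _ inp D _
    (fun j A => \sum_i (A i j)^-1) #|'I_m| c2.
  apply: known_sum => [|i]; first exact/e/e2/e1.
  exact: e _ (e2 _ (inv1 (i, j))).
(* The sum of all inverses, then the row means and the column means. *)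
have [||c4 [s4 e4] tot4] := @known_sum _ _ _ inp D _
    (fun i A => \sum_j (A i j)^-1) c3; [exact/e3/e2/e1|by move=> i; apply/e3|].
have [|i|_ _ A _|c5 [s5 e5] mean5] := @known_family_op _ _ _ inp D _ OpDiv
    (fun i A => \sum_j (A i j)^-1) (fun _ _ => n%:R) c4.
- by move=> i; apply/e4/e3.
- exact/e4/e3/e2/e1.
- exact: nC0.
have [|j|_ _ A _|c6 [s6 e6] mean6] := @known_family_op _ _ _ inp D _ OpDiv
    (fun j A => \sum_i (A i j)^-1) (fun _ _ => m%:R) c5.
- by move=> j; apply/e5/e4.
- exact/e5/e4/e3/e2/e1.
- exact: mC0.
(* The total mean, and the two multiples of it that shift the means. *)
have [|||c7 [s7 e7] tot7] := @known_op _ _ _ inp D OpDiv c6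
    (fun A => \sum_i \sum_j (A i j)^-1) (fun=> (m * n)%:R).
- exact/e6/e5.
- exact/e6/e5/e4/e3/e2/e1.
- by move=> _ A _; rewrite natrM mulf_neq0.
have {}tot7 : known inp D c7 (fun A => total_mean A).
  by apply: eq_known tot7 => A _; rewrite total_meanE.
have k7 k : known inp D c7 (fun=> k%:R) by exact: known_const tot7.
have [//|c8 [s8 e8] shift8] := known_op (o := OpMul) (k7 m) tot7.
have [|c9 [s9 e9] shift9] := known_op (o := OpDiv) shift8 (e8 _ (k7 (m + n)%N)).
  by move=> _ A _; exact: mnC0.
have [//|c10 [s10 e10] shift10] :=
  known_op (o := OpMul) (e9 _ (e8 _ (k7 n))) (e9 _ (e8 _ tot7)).
have [|c11 [s11 e11] shift11] :=
    known_op (o := OpDiv) shift10 (e10 _ (e9 _ (e8 _ (k7 (m + n)%N)))).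
  by move=> _ A _; exact: mnC0.
(* The two blocks of the output. *)
have [||//|c12 [s12 e12] out12] := @known_family_op _ _ _ inp D _ OpSub
    (fun i A => row_mean A i 0)
    (fun _ A => m%:R * total_mean A / (m + n)%:R) c11.
- move=> i; apply/e11/e10/e9/e8/e7/e6; apply: eq_known (mean5 i) => A _.
  by rewrite row_meanE.
- by move=> i; apply/e11/e10.
have [||//|c13 [s13 e13] out13] := @known_family_op _ _ _ inp D _ OpSub
    (fun _ A => n%:R * total_mean A / (m + n)%:R)
    (fun j A => col_mean A j 0) c12.
- by move=> j; apply/e12.
- move=> j; apply/e12/e11/e10/e9/e8/e7; apply: eq_known (mean6 j) => A _.
  by rewrite col_meanE.
have [||P costP computesP] := @slp_of_known _ _ _ inp D _
    (fun k A => centered_means A k 0) c13.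
- exact/e13/e12/e11/e10/e9/e8/k7.
- move=> k; case: (split_ordP k) => k' ->.
    by apply: eq_known (e13 _ (out12 k')) => A _; rewrite centered_means_lshift.
  by apply: eq_known (out13 k') => A _; rewrite centered_means_rshift.
exists P; last exact: computesP.
rewrite costP; rewrite /= !(card_prod, card_ord) in s1 s2 s3 s4 s5 s6 s12 s13.
have mle : (m <= m * n)%N by rewrite leq_pmulr.
have nle : (n <= m * n)%N by rewrite leq_pmull.
by rewrite /= in s1; lia.
Qed.
End MeansProgram.

Theorem theorem3p2 (R : realType) :
  (forall (m n : nat) (A : 'M[R[i]]_(m, n)),
     (1 <= m)%N -> (1 <= n)%N -> nonzero_entries A ->
     let U := Umx R[i] m n in
     let b := bvec A in
     let r := row_mean A in
     let c := col_mean A in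
     let sigma := total_mean A in
     let x := mpinv U *m b in
     [/\ forall y : 'cV[R[i]]_(m + n), min_norm_solution U b y <-> y = x,
         x = col_mx (r - (m%:R * sigma / (m + n)%:R) *: ones m)
                    (- c + (n%:R * sigma / (m + n)%:R) *: ones n),
         cauchy_points (usubmx x) (dsubmx x) <->
           (forall k, (U *m mpinv U *m b) k 0 != 0)
       & cauchy_points (usubmx x) (dsubmx x) <->
           (forall i j, r i 0 + c j 0 != sigma)])
  /\
  (exists K : nat, forall m n : nat, (1 <= m)%N -> (1 <= n)%N ->
     exists2 P : slp ('I_m * 'I_n) 'I_(m + n),
       (slp_cost P <= K * (m * n))%N &
       forall A : 'M[R[i]]_(m, n), nonzero_entries A ->
         slp_computes (fun ij => A ij.1 ij.2) P
           (fun k => (mpinv (Umx R[i] m n) *m bvec A) k 0)).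
Proof.
split=> [m n A m_gt0 n_gt0 _ U b r c sigma x|].
  have xE : x = centered_means A by exact: mpinv_Umx.
  split; first exact: min_norm_solutionE.
  - exact: xE.
  - by rewrite -mulmxA; exact: cauchy_pointsE.
  split=> [/cauchy_pointsE Ux i j|rc].
    by rewrite -subr_eq0 -Umx_centered_means // -xE.
  apply/cauchy_pointsE => k; case: (mxtens_indexP k) => i j.
  by rewrite xE Umx_centered_means // subr_eq0.
exists 13 => m n m_gt0 n_gt0.
have [P costP computesP] := centered_means_program R[i] m_gt0 n_gt0.
by exists P => // A A0; rewrite mpinv_Umx //; apply: computesP.
Qed.
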